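(* Let $S$ be a finite set of alternatives with $|S|\ge 3$, let $V=\{1,\dots,N\}$ be a finite set of voters, and let $f:\Pi_S^V\to\Pi_S$ be a social welfare function. Then $f$ satisfies Independence of Irrelevant Alternatives (IIA) and the Weak Pareto Principle (WPP) if and only if $f$ is directly dictatorial with some dictator $i\in V$ (i.e. for all $x,y\in S$ and all ${\bf R}\in\Pi_S^V$, $x\le_{f({\bf R})}y$ implies $x\le_{R_i}y$), and $f$ defers over $i$ to some clerical-dictatorial function $g:\Pi_S^{V\setminus\{i\}}\to\Pi_S$.
   Context: $\Pi_S$ denotes the set of complete transitive binary relations (weak preferences) on $S$; for $R\in\Pi_S$ we write $x\le_R y$ for $(x,y)\in R$, and $x<_R y$, $x=_R y$ have the obvious meanings. A configuration is ${\bf R}=(R_1,\dots,R_N)\in\Pi_S^V$. A social welfare function (SWF) is any map $f:\Pi_S^V\to\Pi_S$ (for any finite voter set $V$, possibly empty). IIA: whenever ${\bf P},{\bf Q}\in\Pi_S^V$ agree (for every voter) on the pair $\{x,y\}$, $f({\bf P})$ and $f({\bf Q})$ agree on $\{x,y\}$. WPP: if $x<_{R_j}y$ for all $j\in V$ then $x<_{f({\bf R})}y$. $f$ is null if $x=_{f({\bf R})}y$ for all ${\bf R}$ and all $x,y$. $f$ is dictatorial with dictator $i$ if either for all $x,y,{\bf R}$: $x\le_{f({\bf R})}y\Rightarrow x\le_{R_i}y$, or for all $x,y,{\bf R}$: $x\le_{f({\bf R})}y\Rightarrow y\le_{R_i}x$. For ${\bf R}\in\Pi_S^V$, ${\bf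 R}_{-i}\in\Pi_S^{V\setminus\{i\}}$ is its restriction to voters other than $i$. A dictatorial $f$ with dictator $i$ defers to $g:\Pi_S^{V\setminus\{i\}}\to\Pi_S$ over $i$ if for all $x,y\in S$ and ${\bf R}$ with $x=_{R_i}y$: $x\le_{f({\bf R})}y\iff x\le_{g({\bf R}_{-i})}y$. $f$ is clerical with cleric $C\in\Pi_S$ if for all $x,y,{\bf R}$: $x\le_{f({\bf R})}y\Rightarrow x\le_C y$. For $A\subseteq S$, the restriction $f|_A:\Pi_A^V\to\Pi_A$ is defined by: given ${\bf R}\in\Pi_A^V$ pick any ${\bf R}'\in\Pi_S^V$ agreeing with ${\bf R}$ on all pairs in $A$, and set $x\le_{f|_A({\bf R})}y$ iff $x\le_{f({\bf R}')}y$ for $x,y\in A$; $f|_A$ is well defined if this does not depend on the choice of ${\bf R}'$. Clerical-dictatorial (recursive definition): $f:\Pi_S^V\to\Pi_S$ is clerical-dictatorial if it is null, or $|S|\le 2$, or there is a cleric $C\in\Pi_S$ such that (1) $f$ is clerical with cleric $C$, and (2) for every equivalence class $A$ of $C$: (a) $f|_A$ is well defined and is null, dictatorial, or $|A|=2$; (b) if $f|_A$ is dictatorial (with dictator $j$) then it defers over $j$ to a clerical-dictatorial function $\Pi_A^{V\setminus\{j\}}\to\Pi_A$. *)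

(* Defs.v *)
From HB Require Import structures.
From mathcomp Require Import all_boot.

Set Implicit Arguments.
Unset Strict Implicit.
Unset Printing Implicit Defensive.

Definition weak_order (S : finType) (R : {set S * S}) : bool :=
  [forall x, forall y, ((x, y) \in R) || ((y, x) \in R)] &&
  [forall x, forall y, forall z,
     ((x, y) \in R) && ((y, z) \in R) ==> ((x, z) \in R)].

Record pref (S : finType) :=
  Pref { pref_rel :> {set S * S}; _ : weak_order pref_rel }.

HB.instance Definition _ (S : finType) := [isSub for @pref_rel S].
HB.instance Definition _ (S : finType) := [Finite of pref S by <:].

Definition config (S V : finType) := {ffun V -> pref S}.
Definition swf (S V : finType) := config S V -> pref S.

Notation "x '<=_[' R ] y" := ((x, y) \in pref_rel R)
  (at level 70, R at level 200, y at next level, format "x  '<=_[' R ]  y").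
Notation "x '<_[' R ] y" := ((x <=_[R] y) && ~~ (y <=_[R] x))
  (at level 70, R at level 200, y at next level, format "x  '<_[' R ]  y").
Notation "x '=_[' R ] y" := ((x <=_[R] y) && (y <=_[R] x))
  (at level 70, R at level 200, y at next level, format "x  '=_[' R ]  y").

Definition agree_on (S : finType) (P Q : pref S) (x y : S) : Prop :=
  (x <=_[P] y) = (x <=_[Q] y) /\ (y <=_[P] x) = (y <=_[Q] x).

Definition IIA (S V : finType) (f : swf S V) : Prop :=
  forall (P Q : config S V) (x y : S),
    (forall j : V, agree_on (P j) (Q j) x y) -> agree_on (f P) (f Q) x y.

Definition WPP (S V : finType) (f : swf S V) : Prop :=
  forall (R : config S V) (x y : S),
    (forall j : V, x <_[R j] y) -> x <_[f R] y.

Definition null (S V : finType) (f : swf S V) : Prop :=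
  forall (R : config S V) (x y : S), x =_[f R] y.

Definition directly_dictatorial (S V : finType) (f : swf S V) (i : V) : Prop :=
  forall (x y : S) (R : config S V), x <=_[f R] y -> x <=_[R i] y.

Definition inversely_dictatorial (S V : finType) (f : swf S V) (i : V) : Prop :=
  forall (x y : S) (R : config S V), x <=_[f R] y -> y <=_[R i] x.

Definition dictatorial (S V : finType) (f : swf S V) (i : V) : Prop :=
  directly_dictatorial f i \/ inversely_dictatorial f i.

Definition others (V : finType) (i : V) : finType := {j : V | j != i}.

Definition drop_voter (S V : finType) (i : V) (R : config S V) :
    config S (others i) :=
  [ffun j : others i => R (val j)].

Definition defers (S V : finType) (f : swf S V) (i : V)
    (g : swf S (others i)) : Prop :=
  forall (x y : S) (R : config S V),
    x =_[R i] y -> (x <=_[f R] y <-> x <=_[g (drop_voter i R)] y).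

Arguments defers {S V} f i g.

Definition clerical (S V : finType) (f : swf S V) (C : pref S) : Prop :=
  forall (x y : S) (R : config S V), x <=_[f R] y -> x <=_[C] y.

Definition pref_classes (S : finType) (C : pref S) : {set {set S}} :=
  equivalence_partition (fun x y => x =_[C] y) [set: S].

Section Restriction.

Variables (S V : finType) (A : {set S}).

Definition alts : finType := {x : S | x \in A}.

Definition extends (R : config alts V) (R' : config S V) : bool :=
  [forall j, forall x : alts, forall y : alts,
     (x <=_[R j] y) == (val x <=_[R' j] val y)].

Lemma weak_order_restr (R : pref S) :
  weak_order [set p : alts * alts | val p.1 <=_[R] val p.2].
Proof.
case: R => R /= /andP[/forallP cR /forallP tR].
apply/andP; split; apply/forallP => x; apply/forallP => y.
  by rewrite !inE /=; move/forallP: (cR (val x)); apply.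
apply/forallP => z; rewrite !inE /=.
by move/forallP: (tR (val x)) => /(_ (val y)) /forallP; apply.
Qed.

Definition restr_pref (R : pref S) : pref alts := Pref (weak_order_restr R).

Lemma weak_order_setT : weak_order [set: alts * alts].
Proof.
by apply/andP; split; apply/forallP => x; apply/forallP => y;
  [rewrite !inE | apply/forallP => z; rewrite !inE].
Qed.

(* The [None] branch is never reached, see [extends_exists]. *)
Definition restr (f : swf S V) : swf alts V := fun R =>
  if [pick R' | extends R R'] is Some R' then restr_pref (f R')
  else Pref weak_order_setT.

Definition restr_well_defined (f : swf S V) : Prop :=
  forall (R : config alts V) (R' R'' : config S V),
    extends R R' -> extends R R'' ->
    forall x y : alts, (val x <=_[f R'] val y) = (val x <=_[f R''] val y).

Lemma weak_order_extend (R : pref alts) :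
  weak_order [set p : S * S |
    if insub p.2 is Some y then
      if insub p.1 is Some x then x <=_[R] y else false
    else true].
Proof.
case: R => R /= /andP[/forallP cR /forallP tR].
apply/andP; split; apply/forallP => x; apply/forallP => y.
  rewrite !inE /=; case: (insub x) => [a|]; case: (insub y) => [b|] //.
  by move/forallP: (cR a); apply.
apply/forallP => z; rewrite !inE /=.
case: (insub x) => [a|]; case: (insub y) => [b|]; case: (insub z) => [c|] //.
- by move/forallP: (tR a) => /(_ b) /forallP; apply.
- by rewrite implybT.
Qed.

Lemma extends_exists (R : config alts V) : exists R', extends R R'.
Proof.
exists [ffun j => Pref (weak_order_extend (R j))].
apply/forallP => j; apply/forallP => x; apply/forallP => y.
by rewrite ffunE /= inE /= !valK.
Qed.

End Restriction.

Arguments restr {S V} A f.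
Arguments restr_well_defined {S V} A f.

Inductive clerical_dictatorial :
    forall S V : finType, swf S V -> Prop :=
| CD_null (S V : finType) (f : swf S V) :
    null f -> clerical_dictatorial f
| CD_small (S V : finType) (f : swf S V) :
    #|S| <= 2 -> clerical_dictatorial f
| CD_cleric (S V : finType) (f : swf S V) (C : pref S) :
    clerical f C ->
    (forall A : {set S}, A \in pref_classes C ->
       restr_well_defined A f /\
       (null (restr A f) \/ (exists j : V, dictatorial (restr A f) j)
        \/ #|A| = 2)) ->
    (forall A : {set S}, A \in pref_classes C ->
       forall j : V, dictatorial (restr A f) j ->
       exists g : swf (alts A) (others j),
         defers (restr A f) j g /\ clerical_dictatorial g) ->
    clerical_dictatorial f.

(* Main.v *)
Require Import Defs.
From mathcomp Require Import all_boot.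
From mathcomp Require Import zify.

(** Under IIA the social ranking of a pair depends only on the voters' rankings
of that pair, so profiles may be prescribed freely on two of the three pairs of
a triple.  Hence "[x <= y] for some profile" is a weak order [C], and [f] is
clerical with cleric [C].  Within a class of [C] no comparison is imposed; with
at least three alternatives, either a unanimous strict preference is sometimes
respected, and then always (Pareto), or it is sometimes reversed, and then
always, or it always yields a tie, and then [f] is null.  In the first two cases
Arrow's theorem, applied to [f] or to its reversal, gives a dictator.  Making
the dictator wholly indifferent leaves an IIA function of the remaining voters,
to which [f] defers, and one concludes by induction on the number of voters. *)

Set Implicit Arguments.
Unset Strict Implicit.
Unset Printing Implicit Defensive.

(** * Weak orders and rank functions *)

Section Prefs.
Variable S : finType.
Implicit Types (R P Q : pref S) (x y z : S) (r : S -> nat).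

Lemma pref_total R x y : (x <=_[R] y) || (y <=_[R] x).
Proof. by case: R => R /= /andP[/forallP/(_ x)/forallP/(_ y)]. Qed.

Lemma pref_trans R x y z : x <=_[R] y -> y <=_[R] z -> x <=_[R] z.
Proof.
case: R => R /= /andP[_ /forallP/(_ x)/forallP/(_ y)/forallP/(_ z)].
by move=> /implyP tR xy yz; apply: tR; rewrite xy.
Qed.

Lemma pref_refl R x : x <=_[R] x.
Proof. by have := pref_total R x x; rewrite orbb. Qed.

Lemma pref_nle R x y : ~~ (x <=_[R] y) -> y <=_[R] x.
Proof. by have := pref_total R x y; case: (x <=_[R] y). Qed.

Lemma weak_order_rank r : weak_order [set p : S * S | r p.1 <= r p.2].
Proof.
apply/andP; split; apply/forallP => x; apply/forallP => y.
  by rewrite !inE leq_total.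
apply/forallP => z; rewrite !inE; apply/implyP => /andP[]; exact: leq_trans.
Qed.

Definition rank_pref r : pref S := Pref (weak_order_rank r).

Lemma rank_prefE r x y : (x <=_[rank_pref r] y) = (r x <= r y).
Proof. by rewrite inE. Qed.

(** A utility function for [R]: the number of alternatives strictly below [x]. It lets new profiles
    be built by arithmetic on levels. *)
Definition rank R x : nat := #|[set w | ~~ (x <=_[R] w)]|.

Lemma leq_rank R x y : (rank R x <= rank R y) = (x <=_[R] y).
Proof.
apply/idP/idP => [|xy]; last first.
  apply: subset_leq_card; apply/subsetP => w; rewrite !inE.
  by apply: contraNN => /(pref_trans xy).
apply: contraLR => nxy; rewrite -ltnNge; apply: proper_card.
apply/properP; split; last by exists y; rewrite !inE ?pref_refl.
by apply/subsetP => w; rewrite !inE; apply: contraNN; apply/pref_trans/pref_nle.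
Qed.

Lemma weak_order_rev R : weak_order [set p : S * S | p.2 <=_[R] p.1].
Proof.
apply/andP; split; apply/forallP => x; apply/forallP => y.
  by rewrite !inE pref_total.
apply/forallP => z; rewrite !inE /=; apply/implyP => /andP[yx zy].
exact: pref_trans zy yx.
Qed.

Definition rev_pref R : pref S := Pref (weak_order_rev R).

Lemma rev_prefE R x y : (x <=_[rev_pref R] y) = (y <=_[R] x).
Proof. by rewrite inE. Qed.

Lemma third_alternative x y : 3 <= #|S| -> exists z, (z != x) && (z != y).
Proof.
move=> S3; have : 0 < #|~: [set x; y]|.
  by have := cardsC [set x; y]; have := cards2 x y; lia.
by case/card_gt0P => z; rewrite !inE negb_or; exists z.
Qed.

(* With three alternatives, single-coordinate moves that stay off the diagonal
   connect all ordered pairs of distinct elements. *)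
Lemma offdiagonal_connected (D : S -> S -> Prop) :
    3 <= #|S| ->
    (forall x y z, uniq [:: x; y; z] -> D x y -> D x z) ->
    (forall x y z, uniq [:: x; y; z] -> D x y -> D z y) ->
  forall x y, x != y -> D x y -> forall a b, a != b -> D a b.
Proof.
move=> S3 Dr Dl x y xy Dxy a b ab.
have Dr' u v w : u != v -> u != w -> D u v -> D u w.
  move=> uv uw; have [<- //|vw] := eqVneq v w.
  by apply: Dr; rewrite /= !inE negb_or uv uw vw.
have Dl' u v w : u != v -> w != v -> D u v -> D w v.
  move=> uv wv; have [<- //|uw] := eqVneq u w.
  by apply: Dl; rewrite /= !inE negb_or uv uw eq_sym wv.
(* For [b != x], go (x,y), (x,b), (a,b). For [b = x] that path meets the diagonal, so it detours
   through [z]: (x,y), (x,z), (a,z), (a,x). *)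
have [bx|bx] := eqVneq b x; last first.
  by apply: (Dl' x) => //; [rewrite eq_sym | apply: Dr' Dxy; rewrite // eq_sym].
rewrite {b}bx in ab *.
have [z /andP[zx za]] := third_alternative x a S3.
apply: (Dr' a z) => //; first by rewrite eq_sym.
apply: (Dl' x); [by rewrite eq_sym | by rewrite eq_sym |].
by apply: Dr' Dxy; rewrite // eq_sym.
Qed.

End Prefs.

(** * Profiles prescribed on a triple *)

Section Triples.
Variables (S V : finType).

Lemma triple_config (x y z : S) (a b c : V -> nat) :
  uniq [:: x; y; z] ->
  exists R : config S V, forall j,
    ((((x <=_[R j] y) = (a j <= b j)) * ((y <=_[R j] x) = (b j <= a j))) *
     (((y <=_[R j] z) = (b j <= c j)) * ((z <=_[R j] y) = (c j <= b j))) *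
     (((x <=_[R j] z) = (a j <= c j)) * ((z <=_[R j] x) = (c j <= a j))))%type.
Proof.
rewrite /= !inE negb_or => /and3P[/andP[xy xz] yz _].
exists [ffun j => rank_pref
  (fun w => if w == x then a j else if w == y then b j else c j)] => j.
by rewrite ffunE !rank_prefE !eqxx [y == x]eq_sym [z == x]eq_sym [z == y]eq_sym
  (negPf xy) (negPf xz) (negPf yz).
Qed.

Variable f : swf S V.

Lemma IIA_intro :
  (forall (P Q : config S V) x y, (forall j, agree_on (P j) (Q j) x y) ->
     x <=_[f P] y -> x <=_[f Q] y) -> IIA f.
Proof.
move=> H P Q x y PQ.
have PQ' j : agree_on (P j) (Q j) y x by case: (PQ j).
by split; apply/idP/idP; apply: H => // j; case: (PQ j).
Qed.

Lemma IIA_le (P Q : config S V) x y : IIA f ->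
  (forall j, agree_on (P j) (Q j) x y) -> (x <=_[f P] y) = (x <=_[f Q] y).
Proof. by move=> fI /fI[]. Qed.

Lemma IIA_lt (P Q : config S V) x y : IIA f ->
  (forall j, agree_on (P j) (Q j) x y) -> (x <_[f P] y) = (x <_[f Q] y).
Proof. by move=> fI /fI[-> ->]. Qed.

Lemma lt_le_trans (R : pref S) x y z :
  x <_[R] y -> y <=_[R] z -> x <_[R] z.
Proof.
move=> /andP[xy nyx] yz; rewrite (pref_trans xy yz).
by apply: contraNN nyx => /(pref_trans yz).
Qed.

Lemma le_lt_trans (R : pref S) x y z :
  x <=_[R] y -> y <_[R] z -> x <_[R] z.
Proof.
move=> xy /andP[yz nzy]; rewrite (pref_trans xy yz).
by apply: contraNN nzy => /pref_trans; apply.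
Qed.

End Triples.

(** * Arrow's theorem *)

Section Arrow.
Variables (S V : finType) (f : swf S V).
Hypotheses (S3 : 3 <= #|S|) (fI : IIA f) (fP : WPP f).
Implicit Types (G : {set V}) (x y z : S).

Definition decisive G x y : Prop :=
  forall R : config S V, (forall j, j \in G -> x <_[R j] y) -> x <_[f R] y.

Definition almost_decisive G x y : Prop :=
  forall R : config S V,
    (forall j, if j \in G then x <_[R j] y else y <_[R j] x) -> x <_[f R] y.

Lemma decisiveW G x y : decisive G x y -> almost_decisive G x y.
Proof. by move=> dG R GR; apply: dG => j jG; have := GR j; rewrite jG. Qed.

(** The hypothesis on [R] fixes every voter's ranking of the pair, so by IIA one profile speaks for
    all of them. *)
Lemma almost_decisiveP G x y (R : config S V) :
  (forall j, if j \in G then x <_[R j] y else y <_[R j] x) ->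
  x <_[f R] y -> almost_decisive G x y.
Proof.
move=> GR fR Q GQ; rewrite -(IIA_lt (P := R)) // => j.
move: (GR j) (GQ j); case: (j \in G) => /andP[h1 /negPf h2] /andP[h3 /negPf h4];
  by rewrite /agree_on h1 h2 h3 h4.
Qed.

Lemma decisive_right G x y z :
  uniq [:: x; y; z] -> almost_decisive G x y -> decisive G x z.
Proof.
move=> u aG R GR.
have GR' j : j \in G -> rank (R j) x < rank (R j) z.
  by move=> /GR /andP[_]; rewrite ltnNge leq_rank.
(* Doubling opens gaps: [y] goes just above [x] for voters in [G] and to the bottom for the rest.
   Then x < y by [aG] and y < z by Pareto, with x against z as in [R]. *)
have [Q QE] := triple_config (fun j => (rank (R j) x).*2.+1)
  (fun j => if j \in G then (rank (R j) x).*2.+2 else 0)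
  (fun j => (rank (R j) z).*2.+1) u.
rewrite (IIA_lt (Q := Q)) //; last first.
  by move=> j; rewrite /agree_on !QE -!leq_rank; lia.
have xy : x <_[f Q] y.
  by apply: aG => j; rewrite !QE; case: (j \in G); lia.
have /andP[yz _] : y <_[f Q] z; last exact: lt_le_trans xy yz.
by apply: fP => j; rewrite !QE; case: (boolP (j \in G)) => [/GR'|_]; lia.
Qed.

Lemma decisive_left G x y z :
  uniq [:: x; y; z] -> almost_decisive G x y -> decisive G z y.
Proof.
move=> u aG R GR.
have GR' j : j \in G -> rank (R j) z < rank (R j) y.
  by move=> /GR /andP[_]; rewrite ltnNge leq_rank.
(* Dually, [x] goes just above [z] on [G] and above both [y] and [z] elsewhere, so z < x by Pareto
   and x < y by [aG]. *)
have [Q QE] := triple_config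
  (fun j => if j \in G then (rank (R j) z).*2.+1
            else (rank (R j) z + rank (R j) y).*2.+1)
  (fun j => (rank (R j) y).*2) (fun j => (rank (R j) z).*2) u.
rewrite (IIA_lt (Q := Q)) //; last first.
  by move=> j; rewrite /agree_on !QE -!leq_rank; lia.
have xy : x <_[f Q] y.
  by apply: aG => j; rewrite !QE; case: (boolP (j \in G)) => [/GR'|_]; lia.
have /andP[zx _] : z <_[f Q] x; last exact: le_lt_trans zx xy.
by apply: fP => j; rewrite !QE; case: (j \in G); lia.
Qed.

Lemma almost_decisive_decisive G x y :
  x != y -> almost_decisive G x y -> forall a b, a != b -> decisive G a b.
Proof.
move=> xy aG.
have [z /andP[zx zy]] := third_alternative x y S3.
(* The start is (x,z), as [G] is only almost decisive on (x,y). *)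
apply: (@offdiagonal_connected S (decisive G) S3 _ _ x z).
- by move=> u v w uvw /decisiveW; apply: decisive_right.
- by move=> u v w uvw /decisiveW; apply: decisive_left.
- by rewrite eq_sym.
apply: decisive_right aG.
by rewrite /= !inE negb_or xy ![_ == z]eq_sym zx zy.
Qed.

(** Group contraction: a decisive group is split into one member [i] and the rest, and one of the
    two parts is again decisive. *)
Lemma decisive_singleton G :
  (forall a b, a != b -> decisive G a b) ->
  exists i, forall a b, a != b -> decisive [set i] a b.
Proof.
have [n] := ubnP #|G|; elim: n G => // n IHn G Gn dG.
have /card_gt0P[x _] : 0 < #|S| by lia.
have [y /andP[yx _]] := third_alternative x x S3.
have [z /andP[zx zy]] := third_alternative x y S3.
have u : uniq [:: x; y; z].
  by rewrite /= !inE negb_or eq_sym yx ![_ == z]eq_sym zx zy.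
(* An empty decisive group would force both x < y and y < x. *)
have [G0|[i iG]] := set_0Vmem G.
  pose R : config S V := [ffun=> rank_pref (fun=> 0)].
  have /andP[xy _] : x <_[f R] y.
    by apply: (dG x y) => [|j]; rewrite ?G0 ?inE // eq_sym.
  have /andP[_] : y <_[f R] x.
    by apply: (dG y x) => [//|j]; rewrite ?G0 ?inE.
  by rewrite xy.
(* Condorcet cycle: [i] has x < y < z, the rest of [G] has z < x < y, outsiders have y < z < x.
   Socially x < y. If z <= x then z < y, wanted only by [G :\ i]; otherwise x < z, wanted only by
   [i]. *)
have [Q QE] := triple_config
  (fun j => if j == i then 0 else if j \in G then 1 else 2)
  (fun j => if j == i then 1 else if j \in G then 2 else 0)
  (fun j => if j == i then 2 else if j \in G then 0 else 1) u.
have xy : x <_[f Q] y.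
  apply: dG => [|j jG]; first by rewrite eq_sym.
  by rewrite !QE jG; case: eqP.
have [zx_f|/[dup] nzx /pref_nle xz_f] := boolP (z <=_[f Q] x).
  apply: (IHn (G :\ i)).
    by move: Gn; rewrite (cardsD1 i) iG; lia.
  apply: (almost_decisive_decisive zy).
  apply: (almost_decisiveP (R := Q)); last exact: le_lt_trans zx_f xy.
  by move=> j; rewrite !QE !inE; case: eqP => //= _; case: (j \in G).
exists i; apply: (almost_decisive_decisive (x := x) (y := z)).
  by rewrite eq_sym.
apply: (almost_decisiveP (R := Q)); last by rewrite xz_f nzx.
by move=> j; rewrite !QE !inE; case: eqP => //= _; case: (j \in G).
Qed.

Theorem arrow : exists i, directly_dictatorial f i.
Proof.
have [|i di] := @decisive_singleton [set: V].
  by move=> a b _ R aR; apply: fP => j; apply: aR; rewrite inE.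
exists i => x y R xy; apply: contraLR (xy) => nxy.
have yx := pref_nle nxy.
have [xyE|yNx] := eqVneq y x; first by rewrite xyE pref_refl in nxy.
have /andP[//] : y <_[f R] x.
by apply: (di y x yNx) => j /set1P ->; rewrite yx nxy.
Qed.

End Arrow.

(** * Wilson's theorem *)

Section Wilson.
Variables (S V : finType) (f : swf S V).
Hypotheses (S3 : 3 <= #|S|) (fI : IIA f).
Hypothesis f_nonimposed : forall x y : S, exists R : config S V, x <=_[f R] y.

Lemma unanimity_spreads (x y : S) (R0 : config S V) :
  (forall j, x <_[R0 j] y) -> x <_[f R0] y -> WPP f.
Proof.
move=> uR0 fR0.
pose D a b := forall R : config S V, (forall j, a <_[R j] b) -> a <_[f R] b.
have agree (P Q : config S V) a b : (forall j, a <_[P j] b) ->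
    (forall j, a <_[Q j] b) -> forall j, agree_on (P j) (Q j) a b.
  move=> uP uQ j; case/andP: (uP j) (uQ j) => [h1 /negPf h2] /andP[h3 /negPf h4].
  by rewrite /agree_on h1 h2 h3 h4.
have DP a b (R : config S V) : (forall j, a <_[R j] b) -> a <_[f R] b -> D a b.
  by move=> uR fR Q uQ; rewrite -(IIA_lt (P := R)) //; apply: agree.
have xy : x != y.
  by apply: contraTneq fR0 => ->; rewrite andbN.
move=> R a b abR.
have [ab|ab] := eqVneq a b.
  (* No voter can rank [a] strictly below itself, so [V] is empty. *)
  rewrite -ab {b ab} in abR *.
  have V0 : V -> False by move=> j; have := abR j; rewrite andbN.
  (* Without voters there is a single profile, so nonimposition contradicts the strict [fR0]. *)
  have [Q fQ] := f_nonimposed y x.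
  have QR0 : Q = R0 by apply/ffunP => j; case: (V0 j).
  by rewrite -QR0 fQ andbF in fR0.
apply: (@offdiagonal_connected S D S3 _ _ x y xy (DP _ _ _ uR0 fR0) a b ab R abR).
- move=> u v w uvw Duv.
  have [Q fQ] := f_nonimposed v w.
  (* Everyone puts [u] below a copy of [Q] on [v] and [w]: socially u < v <= w. *)
  have [T TE] := triple_config (fun=> 0) (fun j => (rank (Q j) v).+1)
    (fun j => (rank (Q j) w).+1) uvw.
  apply: (DP _ _ T); first by move=> j; rewrite !TE.
  apply: lt_le_trans (Duv T _) _; first by move=> j; rewrite !TE.
  by rewrite (IIA_le (Q := Q)) // => j; rewrite /agree_on !TE !ltnS !leq_rank.
- move=> u v w uvw Duv.
  have [Q fQ] := f_nonimposed w u.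
  (* Everyone puts [v] above a copy of [Q] on [w] and [u]: socially w <= u < v. *)
  have [T TE] := triple_config (fun j => rank (Q j) u)
    (fun j => (rank (Q j) u + rank (Q j) w).+1) (fun j => rank (Q j) w) uvw.
  apply: (DP _ _ T); first by move=> j; rewrite !TE; lia.
  apply: le_lt_trans (Duv T _); last by move=> j; rewrite !TE; lia.
  by rewrite (IIA_le (Q := Q)) // => j; rewrite /agree_on !TE !leq_rank.
Qed.

(** Place a third alternative [z] above both for everyone: each ties with [z], hence they tie with
    each other. *)
Lemma unanimous_ties_null :
  (forall (x y : S) (R : config S V), (forall j, x <_[R j] y) -> x =_[f R] y) ->
  null f.
Proof.
move=> ties R x y.
have [->|xy] := eqVneq x y; first by rewrite pref_refl.
have [z /andP[zx zy]] := third_alternative x y S3.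
have u : uniq [:: x; y; z] by rewrite /= !inE negb_or xy ![_ == z]eq_sym zx zy.
have [T TE] := triple_config (fun j => rank (R j) x) (fun j => rank (R j) y)
  (fun j => (rank (R j) x + rank (R j) y).+1) u.
have [<- <-] : agree_on (f T) (f R) x y.
  by apply: fI => j; rewrite /agree_on !TE !leq_rank.
have /andP[xz zx'] : x =_[f T] z by apply: ties => j; rewrite !TE; lia.
have /andP[yz zy'] : y =_[f T] z by apply: ties => j; rewrite !TE; lia.
by rewrite (pref_trans xz zy') (pref_trans yz zx').
Qed.

End Wilson.

Theorem wilson (S V : finType) (f : swf S V) :
  3 <= #|S| -> IIA f ->
  (forall x y : S, exists R : config S V, x <=_[f R] y) ->
  null f \/ exists i, dictatorial f i.
Proof.
move=> S3 fI fN.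
have [/existsP[[[x y] R] /andP[/forallP uR fR]]|noWPP] :=
  boolP [exists t : S * S * config S V,
    [forall j, t.1.1 <_[t.2 j] t.1.2] && (t.1.1 <_[f t.2] t.1.2)].
  right; have [i di] := arrow S3 fI (unanimity_spreads S3 fI fN uR fR).
  by exists i; left.
(* A direct dictator of the reversal [f'] is an inverse dictator of [f]. *)
pose f' : swf S V := fun R => rev_pref (f R).
have f'I : IIA f'.
  by move=> P Q x y /fI[e1 e2]; split; rewrite !rev_prefE ?e1 ?e2.
have f'N x y : exists R : config S V, x <=_[f' R] y.
  by have [R fR] := fN y x; exists R; rewrite rev_prefE.
have [/existsP[[[x y] R] /andP[/forallP uR fR]]|noWPP'] :=
  boolP [exists t : S * S * config S V,
    [forall j, t.1.1 <_[t.2 j] t.1.2] && (t.1.1 <_[f' t.2] t.1.2)].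
  right; have [i di] := arrow S3 f'I (unanimity_spreads S3 f'I f'N uR fR).
  by exists i; right=> a b Q ab; apply: di; rewrite rev_prefE.
left; apply: unanimous_ties_null => // x y R uR.
move/existsPn/(_ (x, y, R)): noWPP; move/existsPn/(_ (x, y, R)): noWPP'.
have -> /= : [forall j, x <_[R j] y] by apply/forallP.
rewrite !rev_prefE; have := pref_total (f R) x y.
by case: (x <=_[f R] y); case: (y <=_[f R] x).
Qed.

(** * Restrictions and deferral *)

Section Restrict.
Variables (S V : finType) (A : {set S}) (f : swf S V).

Lemma extendsP (R : config (alts A) V) (R' : config S V) :
  reflect (forall j (x y : alts A), (x <=_[R j] y) = (val x <=_[R' j] val y))
    (extends R R').
Proof.
by apply: (iffP 'forall_'forall_'forall_eqP) => H j x y; apply: H.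
Qed.

Lemma restrE (R : config (alts A) V) (R' : config S V) x y :
  restr_well_defined A f -> extends R R' ->
  (x <=_[restr A f R] y) = (val x <=_[f R'] val y).
Proof.
move=> wf RR'; rewrite /restr; case: pickP => [R'' RR''|/(_ R')].
  by rewrite inE; apply: wf RR'' RR' _ _.
by rewrite RR'.
Qed.

Definition restr_config (R : config S V) : config (alts A) V :=
  [ffun j => restr_pref A (R j)].

Lemma extends_restr_config R : extends (restr_config R) R.
Proof. by apply/extendsP => j x y; rewrite ffunE inE. Qed.

Lemma IIA_restr_well_defined : IIA f -> restr_well_defined A f.
Proof.
move=> fI R R' R'' /extendsP RR' /extendsP RR'' x y.
by apply: IIA_le => // j; rewrite /agree_on -!RR' -!RR''.
Qed.

Lemma IIA_restr : IIA f -> IIA (restr A f).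
Proof.
move=> fI; have wf := IIA_restr_well_defined fI.
apply: IIA_intro => P Q x y PQ.
have [P' PP'] := extends_exists P; have [Q' QQ'] := extends_exists Q.
rewrite (restrE _ _ wf PP') (restrE _ _ wf QQ') (IIA_le (Q := Q')) // => j.
by move: (PQ j); rewrite /agree_on !(extendsP _ _ PP') !(extendsP _ _ QQ').
Qed.

End Restrict.

Section Defer.
Variables (S V : finType) (f : swf S V) (i : V).

Definition add_indifferent (R : config S (others i)) : config S V :=
  [ffun j => if (insub j : option {k : V | k != i}) is Some k then R k
             else rank_pref (fun=> 0)].

Definition deferred : swf S (others i) := fun R => f (add_indifferent R).

Lemma IIA_deferred : IIA f -> IIA deferred.
Proof.
move=> fI P Q x y PQ; apply: fI => j; rewrite !ffunE.
by case: insubP => [k _ _|_]; [apply: PQ | split].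
Qed.

Lemma defers_deferred : IIA f -> defers f i deferred.
Proof.
move=> fI x y R /andP[xy yx].
rewrite /deferred -(IIA_le (P := R)) // => j; rewrite !ffunE.
case: insubP => [k _ <-|]; first by rewrite ffunE.
by rewrite negbK => /eqP ->; rewrite /agree_on !rank_prefE xy yx.
Qed.

Lemma card_others : #|others i| < #|V|.
Proof.
rewrite card_sig [ltnRHS](cardD1 i) inE ltnS.
by apply/subset_leq_card/subsetP=> j; rewrite !inE andbT.
Qed.

(** Where [i] is indifferent, [g] decides and is IIA. Where [i] is strict, opposite social rankings
    of the pair in [P] and [Q] would make [i] indifferent. *)
Lemma IIA_defers (g : swf S (others i)) :
  dictatorial f i -> defers f i g -> IIA g -> IIA f.
Proof.
move=> fd fg gI; apply: IIA_intro => P Q x y PQ fxy.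
have [Pxy|nPxy] := boolP (x =_[P i] y).
  have Qxy : x =_[Q i] y by case: (PQ i) Pxy => -> ->.
  apply/(fg x y Q Qxy); rewrite -(IIA_le (P := drop_voter i P)) //.
    exact/(fg x y P Pxy).
  by move=> j; rewrite !ffunE.
case: (PQ i) nPxy => e1 e2; apply: contraR => /pref_nle fyx.
case: fd => fd; move: (fd _ _ _ fxy) (fd _ _ _ fyx); rewrite ?e1 ?e2.
  by move=> -> ->.
by move=> -> ->.
Qed.

End Defer.

Arguments deferred {S V} f i R.

(** * Clerical-dictatorial functions *)

(** Two distinct alternatives exhaust [S], so profiles agreeing on them are equal. *)
Lemma IIA_small (S V : finType) (f : swf S V) : #|S| <= 2 -> IIA f.
Proof.
move=> S2; apply: IIA_intro => P Q x y PQ.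
have [->|xy] := eqVneq x y; first by rewrite !pref_refl.
have xyT w : w \in [set x; y].
  suff /eqP -> : [set x; y] == [set: S] by rewrite inE.
  by rewrite eqEcard subsetT cardsT cards2 xy.
suff -> : P = Q by [].
apply/ffunP => j; apply/val_inj/setP => -[u v] /=; case: (PQ j) => e1 e2.
by case/set2P: (xyT u) => ->; case/set2P: (xyT v) => ->; rewrite ?pref_refl.
Qed.

Lemma mem_pref_classes (S : finType) (C : pref S) (x y : S) :
  x =_[C] y -> exists2 A, A \in pref_classes C & (x \in A) && (y \in A).
Proof.
move=> xy; exists [set w in [set: S] | x =_[C] w]; first exact: imset_f.
by rewrite !inE !pref_refl xy.
Qed.

Lemma pref_classes_eq (S : finType) (C : pref S) (A : {set S}) (x y : S) :
  A \in pref_classes C -> x \in A -> y \in A -> x <=_[C] y.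
Proof.
case/imsetP => w _ ->; rewrite !inE /= => /andP[_ xw] /andP[wy _].
exact: pref_trans xw wy.
Qed.

(* The recursive occurrence of [clerical_dictatorial] sits under [exists], so the
   generated induction principle is of no use and the fixpoint is explicit. *)
Lemma clerical_dictatorial_IIA (S V : finType) (f : swf S V) :
  clerical_dictatorial f -> IIA f.
Proof.
move: S V f; fix IH 4 => S V f.
case=> [{}S {}V {}f fnull|{}S {}V {}f S2
  |{}S {}V {}f C fC fcl fdef].
- by apply: IIA_intro => P Q x y _ _; case/andP: (fnull Q x y).
- exact: IIA_small.
have restr_IIA A : A \in pref_classes C -> IIA (restr A f).
  move=> CA; case: (fcl A CA) => _ [fnull|[[j fj]|A2]].
  - by apply: IIA_intro => P Q x y _ _; case/andP: (fnull Q x y).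
  - case: (fdef A CA j fj) => g [fg gCD].
    exact: IIA_defers fj fg (IH _ _ _ gCD).
  - by apply: IIA_small; rewrite card_sig A2.
apply: IIA_intro => P Q x y PQ fxy.
(* A strict ranking by [C] settles the pair in every profile; otherwise both lie in one class and
   the restriction decides. *)
have [yx|nyx] := boolP (y <=_[C] x); last first.
  by apply: pref_nle; apply: contraNN nyx; apply: fC.
have [|A CA /andP[xA yA]] := @mem_pref_classes _ C x y.
  by rewrite (fC _ _ _ fxy) yx.
have [wf _] := fcl A CA.
have rE R := restrE (Sub x xA) (Sub y yA) wf (extends_restr_config A R).
move: (rE Q); rewrite !SubK => <-.
rewrite -(IIA_le (P := restr_config A P)); first by rewrite rE !SubK.
  exact: restr_IIA.
by move=> j; have := PQ j; rewrite /agree_on !ffunE !inE !SubK.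
Qed.

(** * The cleric of an IIA function *)

Section Cleric.
Variables (S V : finType) (f : swf S V).
Hypothesis fI : IIA f.

Lemma weak_order_cleric :
  weak_order [set p : S * S | [exists R : config S V, p.1 <=_[f R] p.2]].
Proof.
apply/andP; split; apply/forallP => x; apply/forallP => y.
  rewrite !inE /=; pose R : config S V := [ffun=> rank_pref (fun=> 0)].
  by have /orP[xy|xy] := pref_total (f R) x y; apply/orP; [left|right];
    apply/existsP; exists R.
apply/forallP => z; rewrite !inE /=.
apply/implyP => /andP[/existsP[P fPxy] /existsP[Q fQyz]]; apply/existsP.
have [->|xy] := eqVneq x y; first by exists Q.
have [<-|yz] := eqVneq y z; first by exists P.
have [<-|xz] := eqVneq x z; first by exists P; rewrite pref_refl.
(* The common summands cancel: x against y is as in [P], y against z as in [Q]. *)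
have [|T TE] := @triple_config S V x y z
  (fun j => rank (P j) x + rank (Q j) y) (fun j => rank (P j) y + rank (Q j) y)
  (fun j => rank (P j) y + rank (Q j) z).
  by rewrite /= !inE negb_or xy xz yz.
exists T; apply: (@pref_trans _ _ _ y).
  rewrite (IIA_le (Q := P)) // => j.
  by rewrite /agree_on !TE !leq_add2r !leq_rank.
rewrite (IIA_le (Q := Q)) // => j.
by rewrite /agree_on !TE !leq_add2l !leq_rank.
Qed.

Definition cleric : pref S := Pref weak_order_cleric.

Lemma clericP x y : reflect (exists R : config S V, x <=_[f R] y) (x <=_[cleric] y).
Proof. by rewrite inE; apply: existsP. Qed.

Lemma clerical_cleric : clerical f cleric.
Proof. by move=> x y R fR; apply/clericP; exists R. Qed.

(** Inside a class every comparison occurs in some profile, which is the nonimposition required by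
    [wilson]. *)
Lemma cleric_class A : A \in pref_classes cleric ->
  null (restr A f) \/ (exists j, dictatorial (restr A f) j) \/ #|A| = 2.
Proof.
move=> CA; have wf := IIA_restr_well_defined (A := A) fI.
have [A3|A2] := leqP 3 #|A|.
  have [||x y|?|?] := @wilson (alts A) V (restr A f); last 2 first.
  - by left.
  - by right; left.
  - by rewrite card_sig.
  - exact: IIA_restr.
  have /clericP[R fR] := pref_classes_eq CA (valP x) (valP y).
  by exists (restr_config A R); rewrite (restrE _ _ wf (extends_restr_config A R)).
have [A2'|A1] := eqVneq #|A| 2; first by right; right.
left=> R x y; suff -> : x = y by rewrite pref_refl.
have /card_le1_eqP A1' : #|A| <= 1 by lia.
by apply: val_inj; apply: A1'; apply: valP.
Qed.

End Cleric.

Lemma IIA_clerical_dictatorial (S V : finType) (f : swf S V) :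
  IIA f -> clerical_dictatorial f.
Proof.
(* The induction hypothesis is used only after removing a dictator [j], so an empty [V] is no
   special case. *)
have [n] := ubnP #|V|; elim: n S V f => // n IHn S V f Vn fI.
apply: (@CD_cleric _ _ _ (cleric fI)).
- exact: clerical_cleric.
- by move=> A CA; split; [exact: IIA_restr_well_defined | exact: cleric_class CA].
move=> A CA j _; have rI := IIA_restr (A := A) fI.
exists (deferred (restr A f) j); split; first exact: defers_deferred.
apply: IHn; last exact: IIA_deferred.
by have := card_others j; lia.
Qed.

Theorem theorem4 (S V : finType) (f : swf S V) (hS : 3 <= #|S|) :
  IIA f /\ WPP f <->
  exists i : V, directly_dictatorial f i /\
    exists g : swf S (others i), defers f i g /\ clerical_dictatorial g.
Proof.
split=> [[fI fP]|[i [fi [g [fg gCD]]]]].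
  have [i fi] := arrow hS fI fP; exists i; split=> //.
  exists (deferred f i); split; first exact: defers_deferred.
  exact/IIA_clerical_dictatorial/IIA_deferred.
split; first by apply: IIA_defers fg _; [left | exact: clerical_dictatorial_IIA].
move=> R x y xyR; have /andP[_ nyx] := xyR i.
have nfyx : ~~ (y <=_[f R] x) by apply: contraNN nyx; apply: fi.
by rewrite nfyx (pref_nle nfyx).
Qed.
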